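(* Let $(a_n)$ be an arithmetic sequence with ratios $(b_n)$ such that for each integer $m\ge 1$, $$\lim_{n\to\infty}\frac{\sum_{i=0}^{m-1}(b_{n-i}-1)}{\sum_{i=1}^{n}(b_i-1)}=0,$$ and let $(d_n)$ be the non-arithmetic sequence associated with $(a_n)$. Then $t_{(d_n)}(\mathbb{T})\subsetneq t^s_{(d_n)}(\mathbb{T})$ and $|t^s_{(d_n)}(\mathbb{T})\setminus t_{(d_n)}(\mathbb{T})|=\mathfrak{c}$.
   Context: $\mathbb{T}=\mathbb{R}/\mathbb{Z}$ is the circle group; for real $x$, $\|x\|$ denotes the distance from $x$ to the nearest integer (this is well defined on $\mathbb{T}$). $\mathfrak{c}$ is the cardinality of the continuum. Arithmetic sequence: a sequence of positive integers $(a_n)_{n\ge 0}$ with $1=a_0<a_1<a_2<\cdots$ and $a_n\mid a_{n+1}$ for every $n$. Its ratios are $b_n=a_n/a_{n-1}$ for $n\ge 1$ (integers $\ge 2$). (In the limit above, $n\ge m$.) Associated sequence: $(d_n)_{n\ge 1}$ is the increasing enumeration of the set $\{r a_k : k\ge 0,\ 1\le r<b_{k+1}\}$. Density: for $A\subseteq\mathbb{N}$, $\overline{d}(A)=\limsup_{n\to\infty}\frac{|A\cap[0,n-1]|}{n}$ and $\underline{d}(A)=\liminf_{n\to\infty}\frac{|A\cap[0,n-1]|}{n}$; if they are equal the common value is the natural density $d(A)$. For a sequence of integers $(u_n)$, the characterized subgroup is $t_{(u_n)}(\mathbb{T})=\{x\in\mathbb{T}:u_nx\to0 \text{ in }\mathbb{T}\}$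 (i.e. $\|u_nx\|\to0$), and the statistically characterized subgroup is $t^s_{(u_n)}(\mathbb{T})=\{x\in\mathbb{T}: u_nx\to 0 \text{ statistically}\}$, where $u_nx\to0$ statistically means that for every $\varepsilon>0$ the set $\{n:\|u_nx\|\ge\varepsilon\}$ has natural density $0$. *)

(* Defs.v *)
From HB Require Import structures.
From mathcomp Require Import all_boot all_order all_algebra generic_quotient.
From mathcomp Require Import ring_quotient finmap.
From mathcomp Require Import all_classical all_reals all_analysis.

Set Implicit Arguments.
Unset Strict Implicit.
Unset Printing Implicit Defensive.

Import Order.TTheory GRing.Theory Num.Theory.
Import numFieldNormedType.Exports.

Local Open Scope classical_set_scope.
Local Open Scope ring_scope.

(* [Num.int] as a subgroup; its closure instances are attached to the
   predicate [Num.int_num_subdef] underlying the qualifier. *)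
Definition int_zmodClosed (R : realType) : zmodClosed R :=
  GRing.ZmodClosed.clone R (@Num.int_num_subdef R) _.

Definition circle (R : realType) : Type := Quotient.quot (int_zmodClosed R).

Definition dist_int (R : realType) (x : R) : R :=
  inf [set `|x - k%:~R| | k in [set: int]].

Definition circle_norm (R : realType) (t : circle R) : R := dist_int (repr t).

Lemma dist_intDz (R : realType) (x : R) (k : int) :
  dist_int (x + k%:~R) = dist_int x.
Proof.
rewrite /dist_int; congr inf; apply/seteqP; split=> _ [j _ <-] /=.
  by exists (j - k) => //; rewrite rmorphB opprB addrA.
by exists (j + k) => //; rewrite rmorphD opprD addrACA subrr addr0.
Qed.

Lemma circle_norm_pi (R : realType) (x : R) :
  circle_norm (\pi_(circle R) x)%qT = dist_int x.
Proof.
have /intrP[k e] : x - repr (\pi_(circle R) x)%qT \is a Num.int.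
  have /= -> := Quotient.idealrBE (int_zmodClosed R) x
    (repr (\pi_(circle R) x)%qT).
  by rewrite reprK.
by rewrite /circle_norm -[in RHS](subrK (repr (\pi_(circle R) x)%qT) x) e addrC dist_intDz.
Qed.

Definition upper_density (R : realType) (A : set nat) : R :=
  limn_sup (fun n : nat => (#|` fset_set (A `&` `I_n)|)%:R / n%:R : R).

Definition lower_density (R : realType) (A : set nat) : R :=
  limn_inf (fun n : nat => (#|` fset_set (A `&` `I_n)|)%:R / n%:R : R).

Definition has_natural_density (R : realType) (A : set nat) (delta : R) : Prop :=
  upper_density R A = delta /\ lower_density R A = delta.

(* In this and the next definition [u] stands for the sequence (u_n) with
   n >= 1; the value [u 0] is irrelevant. *)
Definition t_char (R : realType) (u : nat -> int) : set (circle R) :=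
  [set x | circle_norm (x *~ u n) @[n --> \oo] --> (0 : R)].

Definition t_stat_char (R : realType) (u : nat -> int) : set (circle R) :=
  [set x | forall eps : R, 0 < eps ->
     has_natural_density
       [set n : nat | (1 <= n)%N /\ eps <= circle_norm (x *~ u n)] (0 : R)].

Arguments t_char R u : clear implicits.
Arguments t_stat_char R u : clear implicits.

Definition arithmetic_sequence (a : nat -> nat) : Prop :=
  [/\ a 0%N = 1%N,
      forall n, (a n < a n.+1)%N
    & forall n, (a n %| a n.+1)%N].

(* b_n for n >= 1; the value at 0 is irrelevant. *)
Definition ratios (a : nat -> nat) (n : nat) : nat := (a n %/ a n.-1)%N.

(* [d] restricted to the indices n >= 1 is the increasing enumeration of
   { r a_k : k >= 0, 1 <= r < b_(k+1) }; the value [d 0] is irrelevant. *)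
Definition associated_sequence (a d : nat -> nat) : Prop :=
  (forall m n, (1 <= m < n)%N -> (d m < d n)%N) /\
  [set d n | n in [set n | (1 <= n)%N]] =
  [set j | exists k r, (1 <= r < ratios a k.+1)%N /\ j = (r * a k)%N].

(* Main.v *)
Require Import Defs.
From mathcomp Require Import all_boot all_order all_algebra.
From mathcomp Require Import all_classical all_reals all_analysis.
From mathcomp Require Import generic_quotient ring_quotient finmap.
From mathcomp Require Import zify ring lra.

Import Order.TTheory GRing.Theory Num.Theory.
Import numFieldNormedType.Exports.

(** The sequence (d_n) runs through consecutive blocks, the k-th block being
    a_k, 2 a_k, ..., (b_(k+1) - 1) a_k; it starts right after the index
    S_k = sum_(i <= k) (b_i - 1) ([associated_blockE]).  The hypothesis says
    that any bounded number of consecutive blocks is negligible with respect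
    to everything before them ([slow_blocks]).

    Let x = sum_i s_i / a_i with digits s_i in {0, 1}.  Modulo 1, a_k x only
    sees the digits of index > k, and if the digits k+1, ..., k+m+1 all vanish,
    then every term of block k sends x to within 2^-m of 0
    ([dist_int_digit_sum_small]).  So for a given precision only the blocks at
    bounded distance before a digit 1 can be bad.  If the 1s are placed at very
    sparse positions g_0 < g_1 < ..., all bad blocks before g_k sit below
    S_(g_(k-1)), which is tiny with respect to S_(g_k - k), and the bad blocks
    attached to g_k itself are negligible by hypothesis; hence the bad
    indices have density 0 and d_n x tends to 0 statistically
    ([marked_size_small], [digit_sum_stat]).

    On the other hand, if s_(k+1) = 1, the multiple (b_(k+1) / 2) a_k, which is
    in the middle of its block, sends x to a point between 1/4 and 3/4.  So
    d_n x does not tend to 0 as soon as s has infinitely many 1s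
    ([digit_sum_notin]).

    Finally, for every k one may choose freely which of the positions g_(2k) and
    g_(2k+1) carries the digit 1; different choices give different points
    of the circle ([digit_sum_inj]).  Reading off the choices from the Dedekind
    cut of a real number embeds R into the difference of the two subgroups;
    conversely the circle embeds into R by choosing representatives, and the
    Cantor-Bernstein theorem concludes. *)

Local Open Scope classical_set_scope.
Local Open Scope nat_scope.

(** * Arithmetic sequences and their blocks *)

(** Number of terms of the associated sequence that precede the multiples of
    [a n]; these multiples thus occupy the indices [block_start a n + r] with
    [0 < r < ratios a n.+1]. *)
Definition block_start (a : nat -> nat) (n : nat) : nat :=
  \sum_(0 <= k < n) (ratios a k.+1).-1.

Lemma block_start0 (a : nat -> nat) : block_start a 0 = 0.
Proof. by rewrite /block_start big_geq. Qed.

Lemma block_startS (a : nat -> nat) (n : nat) :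
  block_start a n.+1 = block_start a n + (ratios a n.+1).-1.
Proof. by rewrite /block_start big_nat_recr. Qed.

Lemma arith_gt0 (a : nat -> nat) (n : nat) : arithmetic_sequence a -> 0 < a n.
Proof. by case=> a0 alt _; case: n => [|n]; rewrite ?a0// (leq_trans _ (alt n)). Qed.

Lemma arithS (a : nat -> nat) (n : nat) :
  arithmetic_sequence a -> a n.+1 = ratios a n.+1 * a n.
Proof. by case=> _ _ adv; rewrite /ratios/= divnK. Qed.

Lemma ratios_gt1 (a : nat -> nat) (n : nat) :
  arithmetic_sequence a -> 1 < ratios a n.+1.
Proof.
move=> aa; have := arithS a n aa; have := arith_gt0 a n aa.
by case: aa => _ /(_ n) alt _; nia.
Qed.

Lemma arith_dvd (a : nat -> nat) (m n : nat) :
  arithmetic_sequence a -> m <= n -> a m %| a n.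
Proof.
move=> [_ _ adv] /subnK <-; elim: (n - m) => [|k IH]; first exact: dvdnn.
by rewrite addSn (dvdn_trans IH).
Qed.

Lemma arith_expn (a : nat -> nat) (m k : nat) :
  arithmetic_sequence a -> 2 ^ k * a m <= a (m + k).
Proof.
move=> aa; elim: k => [|k IH]; first by rewrite mul1n addn0.
by rewrite addnS (arithS a) // expnS; have := ratios_gt1 a (m + k) aa; nia.
Qed.

Lemma leq_block_start (a : nat -> nat) (m n : nat) :
  m <= n -> block_start a m <= block_start a n.
Proof.
by move=> /subnK <-; elim: (n - m) => // k IH; rewrite addSn block_startS; lia.
Qed.

Lemma ltn_block_start (a : nat -> nat) (n : nat) :
  arithmetic_sequence a -> block_start a n < block_start a n.+1.
Proof. by move=> aa; rewrite block_startS; have := ratios_gt1 a n aa; lia. Qed.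

Lemma block_start_ge (a : nat -> nat) (n : nat) :
  arithmetic_sequence a -> n <= block_start a n.
Proof.
by move=> aa; elim: n => // n IH; have := ltn_block_start a n aa; lia.
Qed.

Section Enumeration.
Context {a d : nat -> nat} (aa : arithmetic_sequence a)
  (ad : associated_sequence a d).

(** The successor of [r * a k] in the value set is always [r.+1 * a k]: when
    [r] is the last multiplier of its block this is [a k.+1].  Indeed elements
    of later blocks are multiples of [a k], and elements of earlier blocks are
    smaller than [a k]. *)
Lemma associated_next (n k r : nat) : 0 < n -> 0 < r < ratios a k.+1 ->
  d n = r * a k -> d n.+1 = r.+1 * a k.
Proof.
case: ad => dinc dim n0 r0 dn.
have DE j : (exists2 i, 0 < i & d i = j) <->
    exists l s, 0 < s < ratios a l.+1 /\ j = s * a l.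
  rewrite -[X in _ <-> X]/([set j | exists l s, 0 < s < ratios a l.+1 /\ j = s * a l] j).
  by rewrite -dim; split=> -[i]; exists i.
have ak := arith_gt0 a k aa.
have dle : d n.+1 <= r.+1 * a k.
  have [i i0 di] : exists2 i, 0 < i & d i = r.+1 * a k.
    apply/DE; have [rb|rb] := ltnP r.+1 (ratios a k.+1).
      by exists k, r.+1; split.
    exists k.+1, 1; rewrite ratios_gt1// mul1n (arithS a) //; split=> //.
    by congr (_ * _); lia.
  have [ni|] := ltnP n.+1 i; first by rewrite -di ltnW// dinc// ni.
  rewrite leq_eqVlt => /orP[/eqP <-|]; first by rewrite di.
  rewrite ltnS => iln; suff : d i <= d n by rewrite di dn; nia.
  by move: iln; rewrite leq_eqVlt => /orP[/eqP ->//|iln]; rewrite ltnW// dinc// i0.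
have dgt : r * a k < d n.+1 by rewrite -dn; apply: dinc; rewrite n0 ltnSn.
have [l [s [sb ds]]] : exists l s, 0 < s < ratios a l.+1 /\ d n.+1 = s * a l.
  by apply/DE; exists n.+1.
(* [d n.+1 = s * a l] lies in ]r a_k, (r+1) a_k]: compare the two blocks. *)
have [kl|lk] := leqP k l.
  have /dvdnP[q al] := arith_dvd a k l aa kl.
  move: dgt dle; rewrite ds al mulnA !leq_pmul2r// ltn_pmul2r// => h1 h2.
  by congr (_ * _); apply/eqP; rewrite eqn_leq h1 h2.
exfalso; have := arith_dvd a l.+1 k aa lk => /(dvdn_leq ak).
by rewrite (arithS a) //; move: dgt; rewrite ds; have := arith_gt0 a l aa; nia.
Qed.

Lemma associated1 : d 1 = 1.
Proof.
case: (ad) => dinc dim; case: (aa) => a0 _ _.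
have [i i0 di] : exists2 i, 0 < i & d i = 1.
  have : [set j | exists l s, 0 < s < ratios a l.+1 /\ j = s * a l] 1.
    by exists 0, 1; rewrite ratios_gt1// a0.
  by rewrite -dim => -[i]; exists i.
have [l [s [sb ds]]] : [set j | exists l s, 0 < s < ratios a l.+1 /\ j = s * a l] (d 1).
  by rewrite -dim; exists 1.
have d1 : 0 < d 1 by rewrite ds muln_gt0 arith_gt0//; lia.
move: i0; rewrite leq_eqVlt => /orP[/eqP ie|i1]; first by move: di; rewrite -ie.
by have := dinc 1 i; rewrite i1 di => /(_ erefl); lia.
Qed.

Lemma associated_blockE (k r : nat) : 0 < r < ratios a k.+1 ->
  d (block_start a k + r) = r * a k.
Proof.
have next k' : d (block_start a k' + 1) = 1 * a k' -> forall s,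
    0 < s < ratios a k'.+1 -> d (block_start a k' + s) = s * a k'.
  move=> d1; elim=> // -[|s] IH // sb.
  rewrite addnS; apply: associated_next; [by rewrite addn_gt0 orbT|lia|].
  by apply: IH; lia.
elim: k r => [|k IH] r rb; apply: next => //.
  by rewrite block_start0 associated1; case: aa => ->.
have b1 := ratios_gt1 a k aa.
rewrite block_startS addn1 mul1n (arithS a) //.
rewrite (@associated_next _ k (ratios a k.+1).-1) ?prednK//; try lia.
by apply: IH; lia.
Qed.

End Enumeration.

Lemma block_decomp (a : nat -> nat) (n : nat) : arithmetic_sequence a -> 0 < n ->
  exists k r, 0 < r < ratios a k.+1 /\ n = block_start a k + r.
Proof.
move=> aa n0.
have ex : exists k, n <= block_start a k.
  by exists n; exact: block_start_ge.
case: (ex_minnP ex) => -[|k] nk kmin.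
  by move: nk; rewrite block_start0; lia.
have kn : block_start a k < n.
  by rewrite ltnNge; apply/negP => /kmin; rewrite ltnn.
exists k, (n - block_start a k); split; last by lia.
by move: nk; rewrite block_startS; have := ratios_gt1 a k aa; lia.
Qed.

(** * Sparse positions and density *)

(** The positions at which digits 1 are allowed.  The recursion makes
    [sparse_pos a k.+1 - k.+1] at least [k.+1] times the total size of the
    blocks before [sparse_pos a k]. *)
Fixpoint sparse_pos (a : nat -> nat) (k : nat) : nat :=
  if k is k'.+1 then k.+1 * (block_start a (sparse_pos a k')).+1 else 1.

Lemma sparse_posS_gt (a : nat -> nat) (k : nat) :
  arithmetic_sequence a -> (sparse_pos a k).+1 < sparse_pos a k.+1.
Proof. by move=> aa /=; have := block_start_ge a (sparse_pos a k) aa; nia. Qed.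

Lemma sparse_pos_homo (a : nat -> nat) (k l : nat) :
  arithmetic_sequence a -> k < l -> (sparse_pos a k).+1 < sparse_pos a l.
Proof.
move=> aa; elim: l => // l IH; rewrite ltnS leq_eqVlt => /orP[/eqP ->|/IH h].
  exact: sparse_posS_gt.
by have := sparse_posS_gt a l aa; lia.
Qed.

Lemma sparse_pos_inj (a : nat -> nat) (k l : nat) :
  arithmetic_sequence a -> sparse_pos a k = sparse_pos a l -> k = l.
Proof.
by move=> aa; case: (ltngtP k l) => // /(sparse_pos_homo a _ _ aa); lia.
Qed.

Lemma sparse_pos_lt (a : nat -> nat) (k l : nat) :
  arithmetic_sequence a -> sparse_pos a k < sparse_pos a l -> k < l.
Proof.
move=> aa; case: (ltngtP k l) => [//|/(sparse_pos_homo a _ _ aa)|->]; lia.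
Qed.

Lemma sparse_pos_gt (a : nat -> nat) (k : nat) :
  arithmetic_sequence a -> k < sparse_pos a k.
Proof. by move=> aa; elim: k => // k; have := sparse_posS_gt a k aa; lia. Qed.

Lemma sparse_pos_block (a : nat -> nat) (k n : nat) : arithmetic_sequence a ->
  sparse_pos a k.+1 <= n + k.+1 ->
  k.+1 * block_start a (sparse_pos a k) <= block_start a n.
Proof. by move=> aa /=; have := block_start_ge a n aa; nia. Qed.

(** Block [j] is marked when one of the digits [j + 1, ..., j + m] is 1: these
    are the blocks whose terms may send the digit sum away from 0. *)
Definition marked (s : nat -> bool) (m j : nat) : bool := has s (iota j.+1 m).

Definition marked_size (a : nat -> nat) (s : nat -> bool) (m n : nat) : nat :=
  \sum_(0 <= j < n) marked s m j * (ratios a j.+1).-1.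

Lemma marked_size_le (a : nat -> nat) (s : nat -> bool) (m n : nat) :
  marked_size a s m n <= block_start a n.
Proof. by apply: leq_sum => j _; case: marked; rewrite ?mul1n ?mul0n. Qed.

Lemma marked_size_split (a : nat -> nat) (s : nat -> bool) (m k n : nat) : k <= n ->
  marked_size a s m n <= marked_size a s m k + (block_start a n - block_start a k).
Proof.
move=> kn; rewrite /marked_size (@big_cat_nat _ _ _ k)//= leq_add2l.
rewrite /block_start [X in _ <= X - _](@big_cat_nat _ _ _ k)//= addKn.
by apply: leq_sum => j _; case: marked; rewrite ?mul1n ?mul0n.
Qed.

(** The growth hypothesis with the quotient cleared: the last [m] blocks before
    block [n] make up an arbitrarily small proportion of what precedes it. *)
Definition slow_blocks (a : nat -> nat) : Prop := forall m q : nat,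
  exists K, forall n, K <= n ->
    q * (block_start a n - block_start a (n - m)) <= block_start a n.

(** The marked blocks up to block [n] have negligible total size.  If block [n]
    itself is marked, by position [l.+1] say, then the other marked blocks are
    either among the last [m] ones, negligible since blocks are slow, or before
    position [l], negligible by the choice of the positions.  If it is not,
    nothing has been added since block [n - 1]. *)
Lemma marked_size_small (a : nat -> nat) (s : nat -> bool) (m : nat) :
  arithmetic_sequence a -> slow_blocks a ->
  (forall i, s i -> exists k, i = sparse_pos a k) ->
  forall q, exists C, forall n, q * marked_size a s m n.+1 <= C + block_start a n.
Proof.
move=> aa slow sg q.
have [K1 slow1] := slow 1 2.
have [K2 slow2] := slow m (4 * q).
(* Half of the budget goes to the last [m] blocks, half to the older ones; the
   factor 4 also pays for replacing the start of block n+2 by that of n+1. *)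
pose k0 := (maxn m (2 * q)).+1.
pose K := maxn (maxn K1 K2) (sparse_pos a k0).
exists (q * block_start a K.+1); elim=> [|n IH].
  apply: leq_trans (leq_addr _ _).
  by rewrite leq_mul2l (leq_trans (marked_size_le _ _ _ _)) ?orbT// leq_block_start.
have [nK|Kn] := leqP n.+1 K.
  apply: leq_trans (leq_addr _ _).
  by rewrite leq_mul2l (leq_trans (marked_size_le _ _ _ _)) ?orbT// leq_block_start.
have [mk|mk] := boolP (marked s m n.+1); last first.
  rewrite /marked_size big_nat_recr//= (negPf mk) mul0n addn0.
  by apply: leq_trans IH _; rewrite leq_add2l leq_block_start.
have [l [ln nl]] : exists l, n.+1 < sparse_pos a l.+1 <= n.+1 + m /\ k0 <= l.+1.
  move/hasP: mk => [i]; rewrite mem_iota => ib /sg[l il].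
  have /(sparse_pos_lt a _ _ aa) : sparse_pos a k0 < sparse_pos a l.
    by rewrite -il; move: Kn; rewrite /K; lia.
  by case: l il => [|l il kl]; [lia|exists l; split; lia].
have fl : marked_size a s m (n.+2 - m) <= block_start a (sparse_pos a l).
  rewrite /marked_size.
  have [le|lt] := leqP (n.+2 - m) (sparse_pos a l).
    by apply: leq_trans (marked_size_le a s m _) _; exact: leq_block_start.
  rewrite (@big_cat_nat _ _ _ (sparse_pos a l)) ?(ltnW lt)//=.
  rewrite [X in _ + X]big1_seq ?addn0; first exact: marked_size_le.
  move=> j /andP[_]; rewrite mem_index_iota => jb.
  case: (boolP (marked s m j)) => [|_]; last by rewrite mul0n.
  move/hasP => [i]; rewrite mem_iota => ib /sg[l' il].
  have /(sparse_pos_lt a _ _ aa) : sparse_pos a l < sparse_pos a l' by lia.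
  have /(sparse_pos_lt a _ _ aa) : sparse_pos a l' < sparse_pos a l.+1 by lia.
  by lia.
have bl : l.+1 * block_start a (sparse_pos a l) <= block_start a n.+1.
  by apply: sparse_pos_block => //; lia.
have := marked_size_split a s m (n.+2 - m) n.+2 (leq_subr _ _).
have : 2 * (block_start a n.+2 - block_start a n.+1) <= block_start a n.+2.
  by have := slow1 n.+2; rewrite subSS subn0; apply; lia.
have : 4 * q * (block_start a n.+2 - block_start a (n.+2 - m)) <= block_start a n.+2.
  by apply: slow2; lia.
have := leq_block_start a n.+1 n.+2 (leqnSn _).
have ql : 2 * q <= l.+1 by lia.
have : 2 * q * block_start a (sparse_pos a l) <= block_start a n.+1.
  by apply: leq_trans bl; rewrite leq_mul2r ql orbT.
move: (block_start a n.+2) (block_start a n.+1) fl => T S.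
move: (block_start a (sparse_pos a l)) (block_start a (n.+2 - m)) => X Z.
move: (marked_size a s m (n.+2 - m)) (marked_size a s m n.+2) => f1 f2.
move=> fl h1 h2 h3 h4 h5.
have : q * f2 <= q * (X + (T - Z)) by rewrite leq_mul2l (leq_trans h5) ?orbT// leq_add2r.
by nia.
Qed.

Definition count_below (A : nat -> bool) (N : nat) : nat :=
  \sum_(0 <= n < N) A n.

Lemma count_below_marked (a : nat -> nat) (s A : nat -> bool) (m k : nat) :
  arithmetic_sequence a -> ~~ A 0 ->
  (forall k r, 0 < r < ratios a k.+1 -> ~~ marked s m k ->
     ~~ A (block_start a k + r)) ->
  count_below A (block_start a k).+1 <= marked_size a s m k.
Proof.
move=> aa A0 Ak; elim: k => [|k IH].
  by rewrite block_start0 /count_below big_nat1 (negPf A0).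
rewrite /count_below (@big_cat_nat _ _ _ (block_start a k).+1)//=; last first.
  by rewrite ltnS leq_block_start.
rewrite /marked_size [X in _ <= X]big_nat_recr//=; apply: leq_add; first exact: IH.
case: (boolP (marked s m k)) => mk.
  apply: (@leq_trans (\sum_((block_start a k).+1 <= i < (block_start a k.+1).+1) 1)).
    by apply: leq_sum => i _; case: (A i).
  by rewrite sum_nat_const_nat block_startS mul1n; lia.
rewrite mul0n big1_seq// => i /andP[_]; rewrite mem_index_iota => ib.
have : ~~ A (block_start a k + (i - block_start a k)).
  by apply: Ak => //; move: ib; rewrite block_startS; have := ratios_gt1 a k aa; lia.
by rewrite subnKC; [case: (A i)|lia].
Qed.

(** A set of indices contained in the marked blocks has density 0.  An index
    inside a block is compared with the start of this block, so that the whole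
    current block can be counted. *)
Lemma count_below_small (a : nat -> nat) (s A : nat -> bool) (m : nat) :
  arithmetic_sequence a -> slow_blocks a ->
  (forall i, s i -> exists k, i = sparse_pos a k) -> ~~ A 0 ->
  (forall k r, 0 < r < ratios a k.+1 -> ~~ marked s m k ->
     ~~ A (block_start a k + r)) ->
  forall q, exists C, forall N, q * count_below A N <= C + N.
Proof.
move=> aa slow sg A0 Ak q.
have [C Cn] := marked_size_small a s m aa slow sg q.
exists C => -[|N]; first by rewrite /count_below big_geq// muln0.
have [k [r [rb Nr]]] := block_decomp a N.+1 aa isT.
apply: (@leq_trans (C + block_start a k)); last by lia.
apply: leq_trans (Cn k); rewrite leq_mul2l; apply/orP; right.
apply: leq_trans (count_below_marked a s A m k.+1 aa A0 Ak).
rewrite /count_below [X in _ <= X](@big_cat_nat _ _ _ N.+1)//= ?leq_addr//.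
by rewrite Nr block_startS; lia.
Qed.

Local Open Scope ring_scope.
Local Open Scope card_scope.

Lemma card_below (A : set nat) (N : nat) :
  #|` fset_set (A `&` `I_N)| = count_below (fun n => `[< A n >]) N.
Proof.
elim: N => [|N IH].
  by rewrite II0 setI0 fset_set0 cardfs0 /count_below big_geq.
rewrite /count_below big_nat_recr//= -/(count_below _ _) -IH IIS setIUr.
have fin : finite_set (A `&` `I_N) by apply: finite_setIr; exact: finite_II.
case: asboolP => AN.
  have -> : A `&` `I_N `|` A `&` [set N] = N |` (A `&` `I_N).
    by rewrite setUC; congr (_ `|` _); apply/seteqP; split=> [x []//|x ->].
  rewrite fset_setU1// cardfsU1 addnC; suff -> : N \notin fset_set (A `&` `I_N) by [].
  by rewrite in_fset_set// notin_setE => -[_]/=; rewrite ltnn.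
suff -> : A `&` [set N] = set0 by rewrite setU0 addn0.
by apply/seteqP; split=> // x [Ax xN]; apply: AN; rewrite -xN.
Qed.

(** The hypothesis bounds the proportion of [A] below [N] by
    [C / (q * N) + 1 / q]; no division enters the count of [A]. *)
Lemma density0 (R : realType) (A : set nat) :
  (forall q, exists C, forall N,
     (q * count_below (fun n => `[< A n >]) N <= C + N)%N) ->
  has_natural_density A (0 : R).
Proof.
move=> small.
pose u n : R := (#|` fset_set (A `&` `I_n)|)%:R / n%:R.
have u0 : u n @[n --> \oo] --> (0 : R).
  apply/cvgr0Pnorm_lt => e e0.
  have [C hC] := small (Num.bound (2 / e)).
  near=> n.
  have n0 : (0 < n)%N by near: n; exact: nbhs_infty_gt.
  have Cn : (C <= n)%N by near: n; exact: nbhs_infty_ge.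
  have qe : 2 / e < (Num.bound (2 / e))%:R.
    by rewrite archi_boundP// divr_ge0// ltW.
  rewrite /u card_below; have := hC n.
  move: (count_below _ _) (Num.bound _) qe => c q qe.
  have n0R : (0 : R) < n%:R by rewrite ltr0n.
  rewrite ger0_norm ?divr_ge0// ltr_pdivrMr// => qc.
  have : (q * c)%:R <= (n + n)%:R :> R by rewrite ler_nat (leq_trans qc)// leq_add2r.
  rewrite natrM natrD; move: qe; rewrite ltr_pdivrMr// => qe qcn.
  have q0 : (0 : R) < q%:R by nra.
  rewrite -(ltr_pM2l q0); nra.
have cu : cvgn u by apply/cvg_ex; exists 0.
have lu : limn u = 0 by exact/cvg_lim.
by split; [rewrite /upper_density cvg_limn_supE|rewrite /lower_density cvg_limn_infE].
Unshelve. all: by end_near.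
Qed.

(** * Distance to the nearest integer *)

Section DistInt.
Variable R : realType.
Implicit Types x : R.

Lemma has_lbound_dist_int x :
  has_lbound [set `|x - k%:~R| | k in [set: int]].
Proof. by exists 0 => _ [k _ <-]. Qed.

Lemma dist_int_le_norm x : dist_int x <= `|x|.
Proof.
apply: ge_inf; first exact: has_lbound_dist_int.
by exists 0 => //; rewrite subr0.
Qed.

Lemma dist_int_ge_quarter x : 1/4 <= x <= 3/4 -> 1/4 <= dist_int x.
Proof.
move=> xb; apply: lb_le_inf; first by exists `|x - 0%:~R|, 0.
move=> _ [k _ <-]; have [k0|k1] := lerP k 0.
  have : k%:~R <= 0 :> R by rewrite -[0]/(0%:~R) ler_int.
  by move=> ?; rewrite ger0_norm; lra.
have : 1 <= k%:~R :> R by rewrite -[1]/(1%:~R) ler_int; lia.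
by move=> ?; rewrite ler0_norm; lra.
Qed.

Lemma circle_norm_piMz x (n : int) :
  circle_norm ((\pi_(circle R) x)%qT *~ n) = dist_int (x *~ n).
Proof. by rewrite -circle_norm_pi raddfMz. Qed.

Lemma circle_pi_eq x y : (\pi_(circle R) x = \pi_(circle R) y)%qT ->
  exists k : int, x = y + k%:~R.
Proof.
move=> xy.
have /intrP[k e] : x - y \is a Num.int.
  by have /= -> := Quotient.idealrBE (int_zmodClosed R) x y; exact/eqP.
by exists k; rewrite -e addrC subrK.
Qed.

End DistInt.

(** * Points of the circle with digits 0 and 1 *)

Definition partial_sum (R : realType) (a : nat -> nat) (s : nat -> bool)
  (n : nat) : R := \sum_(0 <= i < n) (s i.+1)%:R / (a i.+1)%:R.

Definition digit_sum (R : realType) (a : nat -> nat) (s : nat -> bool) : R :=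
  limn (partial_sum R a s).

Section DigitSum.
Context {R : realType} {a : nat -> nat} (aa : arithmetic_sequence a)
  (s : nat -> bool).
Local Notation P := (partial_sum R a s).
Local Notation x := (digit_sum R a s).

Lemma partial_sumS n : P n.+1 = P n + (s n.+1)%:R / (a n.+1)%:R.
Proof. by rewrite /partial_sum big_nat_recr. Qed.

Let aR_gt0 n : 0 < (a n)%:R :> R.
Proof. by rewrite ltr0n arith_gt0. Qed.

Lemma arith_invS_le n : (a n.+1)%:R^-1 <= (a n)%:R^-1 / 2 :> R.
Proof.
rewrite -invfM lef_pV2 ?posrE ?mulr_gt0//.
rewrite -natrM ler_nat (arithS a n aa) mulnC leq_mul2r.
by rewrite (ratios_gt1 a n aa) orbT.
Qed.

(** Since [a] at least doubles at each step, [1 / a (i + 1)] is at most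
    [1 / a i - 1 / a (i + 1)], and the sum telescopes. *)
Lemma partial_sum_le n k : P (n + k) <= P n + (a n)%:R^-1 - (a (n + k))%:R^-1.
Proof.
elim: k => [|k IH]; first by rewrite addn0 addrK.
rewrite addnS partial_sumS.
have := arith_invS_le (n + k).
have : 0 < (a (n + k).+1)%:R^-1 :> R by rewrite invr_gt0.
by case: (s _); rewrite ?mul0r ?mul1r; lra.
Qed.

Lemma partial_sum_nondecr : nondecreasing_seq P.
Proof.
apply/nondecreasing_seqP => n; rewrite partial_sumS lerDl.
by rewrite divr_ge0// ler0n.
Qed.

Lemma partial_sum_cvg : cvgn P.
Proof.
apply: nondecreasing_is_cvgn; first exact: partial_sum_nondecr.
exists (a 0%N)%:R^-1 => _ [n _ <-].
have := partial_sum_le 0 n; rewrite add0n {2}/partial_sum big_geq// add0r.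
have : 0 < (a n)%:R^-1 :> R by rewrite invr_gt0.
by lra.
Qed.

Lemma digit_sum_ge n : P n <= x.
Proof. exact: nondecreasing_cvgn_le partial_sum_nondecr partial_sum_cvg n. Qed.

Lemma digit_sum_le n : x <= P n + (a n)%:R^-1.
Proof.
apply: limr_le; first exact: partial_sum_cvg.
near=> m; have nm : (n <= m)%N by near: m; exact: nbhs_infty_ge.
have := partial_sum_le n (m - n); rewrite subnKC//.
have : 0 < (a m)%:R^-1 :> R by rewrite invr_gt0.
by lra.
Unshelve. all: by end_near.
Qed.

(** The crude bound [1 / a n] on the tail is attained when all ratios are 2 and
    all digits are 1; without two consecutive 1s there is room to spare, which
    is what distinguishes digit sums. *)
Lemma digit_sum_le_gap n : (forall i, s i -> ~~ s i.+1) ->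
  x <= P n + 3/4 / (a n)%:R.
Proof.
move=> gap; have := digit_sum_le n.+1; have := digit_sum_le n.+2.
have := gap n.+1; have := arith_invS_le n; have := arith_invS_le n.+1.
have : 0 < (a n.+1)%:R^-1 :> R by rewrite invr_gt0.
have : 0 < (a n)%:R^-1 :> R by rewrite invr_gt0.
rewrite !partial_sumS.
case: (s n.+1); case: (s n.+2); rewrite ?mul0r ?mul1r => ? ? ? ? gp; lra.
Qed.

Lemma partial_sum_integral n : exists z : nat, (a n)%:R * P n = z%:R.
Proof.
elim: n => [|n [z IH]].
  by exists 0%N; rewrite /partial_sum big_geq// mulr0.
exists (ratios a n.+1 * z + s n.+1)%N.
rewrite partial_sumS mulrDr natrD natrM -IH {1}(arithS a n aa) natrM -mulrA.
by congr (_ + _); rewrite mulrC mulfVK// gt_eqF.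
Qed.

(** Multiplying by [a k] turns the first [k] terms of the sum into integers. *)
Lemma dist_int_digit_sum (r k : nat) :
  dist_int (x *~ (r * a k)%N%:Z) = dist_int (r%:R * (a k)%:R * (x - P k)).
Proof.
have [z zP] := partial_sum_integral k.
rewrite -(dist_intDz (r%:R * _ * _) (r * z)%N%:Z); congr dist_int.
rewrite -mulrzr !pmulrn -!pmulrn !natrM -zP; ring.
Qed.

(** With the digits [k + 1, ..., k + m + 1] equal to 0, the tail after [k] is at
    most [1 / a (k + m + 1)], whereas [r * a k < a (k + 1)]. *)
Lemma dist_int_digit_sum_small (r k m : nat) : (0 < r < ratios a k.+1)%N ->
  ~~ marked s m.+1 k -> dist_int (x *~ (r * a k)%N%:Z) <= (2 ^- m).
Proof.
move=> rb unm; rewrite dist_int_digit_sum.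
apply: le_trans (dist_int_le_norm _ _) _.
have Pm : P (k + m.+1) = P k.
  have : forall j, (j <= m.+1)%N -> P (k + j) = P k.
    elim=> [|j IH] jm; first by rewrite addn0.
    rewrite addnS partial_sumS IH ?(ltnW jm)//.
    suff /negPf -> : ~~ s (k + j).+1 by rewrite mul0r addr0.
    apply: contra unm => sj; apply/hasP; exists (k + j).+1 => //.
    by rewrite mem_iota; lia.
  by apply.
have h1 := digit_sum_ge k; have := digit_sum_le (k + m.+1); rewrite Pm => h2.
have xP0 : 0 <= x - P k by rewrite subr_ge0.
rewrite ger0_norm ?mulr_ge0//.
apply: (@le_trans _ _ ((a k.+1)%:R / (a (k + m.+1))%:R)).
  apply: ler_pM => //; rewrite ?mulr_ge0//; last by rewrite lerBlDl.
  by rewrite -natrM ler_nat (arithS a k aa) leq_mul2r ltnW ?orbT//; case/andP: rb.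
rewrite ler_pdivrMr// mulrC ler_pdivlMr ?exprn_gt0//.
by rewrite -natrX -natrM ler_nat mulnC addnS -addSn; exact: arith_expn.
Qed.

(** With [b := ratios a k.+1] and [r := b./2], the digit [k + 1] contributes
    [r / b], between 1/3 and 1/2, to [r * a k] times the tail; the following
    digit being 0, the rest contributes at most half as much. *)
Lemma dist_int_digit_sum_large (k : nat) : (forall i, s i -> ~~ s i.+1) ->
  s k.+1 -> 1/4 <= dist_int (x *~ ((ratios a k.+1)./2 * a k)%N%:Z).
Proof.
move=> gap sk; rewrite dist_int_digit_sum; apply: dist_int_ge_quarter.
have := digit_sum_ge k.+1; have := digit_sum_le k.+2.
rewrite !partial_sumS sk (negPf (gap _ sk)) mul0r addr0 !mul1r.
have := arith_invS_le k.+1.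
have b1 := ratios_gt1 a k aa.
have -> : (a k.+1)%:R^-1 = ((ratios a k.+1)%:R * (a k)%:R)^-1 :> R.
  by rewrite -natrM -(arithS a k aa).
rewrite invfM.
have bi : (ratios a k.+1)%:R * (ratios a k.+1)%:R^-1 = 1 :> R.
  by rewrite divff// pnatr_eq0; lia.
have ai : (a k)%:R * (a k)%:R^-1 = 1 :> R by rewrite divff// gt_eqF.
have r1 : (ratios a k.+1)%:R <= 3 * (ratios a k.+1)./2%:R :> R.
  by rewrite -natrM ler_nat; lia.
have r2 : 2 * (ratios a k.+1)./2%:R <= (ratios a k.+1)%:R :> R.
  by rewrite -natrM ler_nat; lia.
have r0 : 0 <= (ratios a k.+1)./2%:R :> R by [].
have b0 : 0 < (ratios a k.+1)%:R :> R by rewrite ltr0n; lia.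
set b : R := (ratios a k.+1)%:R in bi r1 r2 b0 *.
set r : R := (_./2)%:R in r1 r2 r0 *.
set A : R := (a k)%:R in ai *.
have A0 : 0 < A := aR_gt0 k.
move=> he h1 h2.
set y := x - P k.
have y1 : b^-1 * A^-1 <= y by rewrite /y; lra.
have y2 : y <= 3/2 * (b^-1 * A^-1) by rewrite /y; lra.
have rA0 : 0 <= r * A by rewrite mulr_ge0// ltW.
have e1 : r * A * (b^-1 * A^-1) = r * b^-1 by rewrite mulrACA ai mulr1.
have z1 : r * b^-1 <= r * A * y by rewrite -e1 ler_wpM2l.
have z2 : r * A * y <= 3/2 * (r * b^-1).
  by rewrite -e1 mulrCA ler_wpM2l.
have bi0 : 0 < b^-1 by rewrite invr_gt0.
have w1 : b * b^-1 <= 3 * r * b^-1 by rewrite ler_wpM2r// ltW.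
have w2 : 2 * r * b^-1 <= b * b^-1 by rewrite ler_wpM2r// ltW.
by apply/andP; split; lra.
Qed.

End DigitSum.

(** Digit sums lie in [0, 3/4], so congruent ones are equal.  At the first
    place where the digits differ, the sum with digit 1 exceeds the other one,
    whose tail is too short to catch up. *)
Lemma digit_sum_inj (R : realType) (a : nat -> nat) (s t : nat -> bool) :
  arithmetic_sequence a ->
  (forall i, s i -> ~~ s i.+1) -> (forall i, t i -> ~~ t i.+1) ->
  (\pi_(circle R) (digit_sum R a s) = \pi_(circle R) (digit_sum R a t))%qT ->
  forall n, s n.+1 = t n.+1.
Proof.
move=> aa gs gt /circle_pi_eq[z xy].
have bound (u : nat -> bool) : (forall i, u i -> ~~ u i.+1) -> 0 <= digit_sum R a u <= 3/4.
  move=> gu; have := @digit_sum_ge R _ aa u 0%N; have := @digit_sum_le_gap R _ aa u 0%N gu.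
  rewrite /partial_sum big_geq//; case: (aa) => -> _ _; rewrite divr1 add0r.
  by move=> -> ->.
have z0 : z = 0.
  have /andP[? ?] := bound s gs; have /andP[? ?] := bound t gt.
  have : z%:~R < 1%:~R :> R by lra.
  have : (-1)%:~R < z%:~R :> R by lra.
  by rewrite !ltr_int; lia.
move: xy; rewrite z0 addr0 => xy.
have step (u v : nat -> bool) m : (forall i, v i -> ~~ v i.+1) ->
    digit_sum R a u = digit_sum R a v ->
    partial_sum R a u m = partial_sum R a v m -> u m.+1 -> v m.+1.
  move=> gv uv Puv um; apply/negPn/negP => vm.
  have := @digit_sum_ge R _ aa u m.+1; have := @digit_sum_le_gap R _ aa v m.+1 gv.
  rewrite !partial_sumS um (negPf vm) uv Puv mul0r addr0 !mul1r.
  have : 0 < (a m.+1)%:R^-1 :> R by rewrite invr_gt0 ltr0n arith_gt0.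
  by lra.
have eqst m : partial_sum R a s m = partial_sum R a t m -> s m.+1 = t m.+1.
  by move=> P; apply/idP/idP; apply: step.
move=> n; apply: (eqst); elim: n => [|n IH].
  by rewrite /partial_sum !big_geq.
by rewrite !partial_sumS IH eqst.
Qed.

(** * The growth hypothesis in terms of blocks *)

Lemma sum_ratiosB1 (R : realType) (a : nat -> nat) (n : nat) :
  arithmetic_sequence a ->
  \sum_(1 <= i < n.+1) ((ratios a i)%:R - 1) = (block_start a n)%:R :> R.
Proof.
move=> aa; elim: n => [|n IH]; first by rewrite big_geq// block_start0.
rewrite big_nat_recr//= IH block_startS natrD; congr (_ + _).
by rewrite -subn1 natrB// ltnW// ratios_gt1.
Qed.

Lemma sum_last_ratiosB1 (R : realType) (a : nat -> nat) (m n : nat) :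
  arithmetic_sequence a -> (m <= n)%N ->
  \sum_(0 <= i < m) ((ratios a (n - i))%:R - 1) =
  (block_start a n - block_start a (n - m))%:R :> R.
Proof.
move=> aa; elim: m => [|m IH] mn; first by rewrite big_geq// subn0 subnn.
rewrite big_nat_recr//= IH ?(ltnW mn)//.
have -> : (n - m = (n - m.+1).+1)%N by lia.
have b1 := ratios_gt1 a (n - m.+1) aa.
have := leq_block_start a (n - m) n (leq_subr _ _).
have -> : (n - m = (n - m.+1).+1)%N by lia.
rewrite block_startS => le.
have -> : (ratios a (n - m.+1).+1)%:R - 1 = (ratios a (n - m.+1).+1 - 1)%:R :> R.
  by rewrite natrB// ltnW.
rewrite -natrD.
by congr (_%:R); lia.
Qed.

Lemma slow_blocks_of_cvg (R : realType) (a : nat -> nat) :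
  arithmetic_sequence a ->
  (forall m : nat, (1 <= m)%N ->
     (\sum_(0 <= i < m) ((ratios a (n - i))%:R - 1))
       / (\sum_(1 <= i < n.+1) ((ratios a i)%:R - 1)) @[n --> \oo] --> (0 : R)) ->
  slow_blocks a.
Proof.
move=> aa cvg0 [|m] q; first by exists 0%N => n _; rewrite subn0 subnn muln0.
have e0 : 0 < (q.+1%:R)^-1 :> R by rewrite invr_gt0.
have [K _ Kn] := cvgr0_norm_lt _ (cvg0 m.+1 isT) _ e0.
exists (maxn K m.+1) => n; rewrite geq_max => /andP[Kln mn].
have := Kn n Kln; rewrite /= sum_ratiosB1// sum_last_ratiosB1//.
have S0 : 0 < (block_start a n)%:R :> R.
  by rewrite ltr0n (leq_trans _ (block_start_ge a n aa))// (leq_ltn_trans _ mn).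
rewrite ger0_norm ?divr_ge0// ltr_pdivrMr// mulrC ltr_pdivlMr//.
by rewrite -natrM ltr_nat; lia.
Qed.

(** * Statistical and ordinary convergence on the circle *)

Lemma t_char_sub_stat (R : realType) (u : nat -> int) :
  t_char R u `<=` t_stat_char R u.
Proof.
move=> x xu e e0; apply: density0 => q.
have [K _ Kn] := cvgr0_norm_lt _ xu _ e0.
exists (q * K)%N => N; apply: leq_trans (leq_addr _ _); rewrite leq_mul2l; apply/orP; right.
elim: N => [|N IH]; first by rewrite /count_below big_geq.
rewrite /count_below big_nat_recr//=; case: asboolP => [[N0 eN]|_]; last by rewrite addn0.
have NK : (N < K)%N.
  rewrite ltnNge; apply/negP => /Kn/=.
  by rewrite ltNge => /negP; apply; rewrite (le_trans eN)// ler_norm.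
apply: leq_trans NK; rewrite addn1 ltnS.
by rewrite -[X in (_ <= X)%N]subn0 -[X in (_ <= X)%N]muln1 -sum_nat_const_nat;
  apply: leq_sum => i _; case: asboolP.
Qed.

Section Membership.
Context {R : realType} {a d : nat -> nat} {s : nat -> bool}
  (aa : arithmetic_sequence a) (ad : associated_sequence a d).
Local Notation pt := (\pi_(circle R) (digit_sum R a s))%qT.

(** The terms that stay [e]-away from 0 are all in blocks marked for a single
    [m], depending on [e] only. *)
Lemma digit_sum_stat : slow_blocks a ->
  (forall i, s i -> exists k, i = sparse_pos a k) ->
  t_stat_char R (fun n => (d n)%:Z) pt.
Proof.
move=> slow sg e e0; apply: density0.
have [m me] : exists m, 2 ^- m < e.
  have h : `|2^-1 : R| < 1 by rewrite ger0_norm; lra.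
  have [m _ /(_ m (leqnn m))/= me] :=
    cvgr0_norm_lt _ (cvg_expr h) _ e0.
  by exists m; rewrite -exprVn (le_lt_trans (ler_norm _)).
apply: (count_below_small a s _ m.+1 aa slow sg).
  by apply/asboolP => -[].
move=> k r rb unm; apply/asboolP => -[_].
rewrite circle_norm_piMz (associated_blockE aa ad)// => eN.
have le := dist_int_digit_sum_small (R := R) aa s r k m rb unm.
by have := le_lt_trans (le_trans eN le) me; rewrite ltxx.
Qed.

Lemma digit_sum_notin : (forall i, s i -> ~~ s i.+1) ->
  (forall K, exists2 k, (K <= k)%N & s k.+1) ->
  ~ t_char R (fun n => (d n)%:Z) pt.
Proof.
move=> gap unb cv.
have q0 : 0 < 1/4 :> R by lra.
have [K _ Kn] := cvgr0_norm_lt _ cv _ q0.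
have [k Kk sk] := unb K.
have rb : (0 < (ratios a k.+1)./2 < ratios a k.+1)%N.
  by have := ratios_gt1 a k aa; lia.
have := Kn (block_start a k + (ratios a k.+1)./2)%N.
rewrite /= circle_norm_piMz (associated_blockE aa ad)// => /(_ _) h.
have := dist_int_digit_sum_large (R := R) aa s k gap sk.
rewrite leNgt => /negP; apply; apply: le_lt_trans (ler_norm _) (h _).
by have := block_start_ge a k aa; lia.
Qed.

End Membership.

(** * Digits read off from a real number *)

(** Indicator of the Dedekind cut of [r], along an enumeration of the
    rationals. *)
Definition cut_bit (R : realType) (r : R) (k : nat) : bool :=
  if (choice.unpickle k : option rat) is Some q then ratr q < r else false.

Lemma cut_bit_inj (R : realType) : injective (@cut_bit R).
Proof.
suff lt r1 r2 : r1 < r2 -> cut_bit R r1 <> cut_bit R r2.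
  by move=> r1 r2 e; case: (ltgtP r1 r2) => // /lt; rewrite e.
move=> /rat_in_itvoo[q]; rewrite in_itv/= => /andP[h1 h2].
move=> /(congr1 (@^~ (choice.pickle q))); rewrite /cut_bit choice.pickleK h2.
by rewrite ltNge (ltW h1).
Qed.

(** Bit [k] decides whether the position of index [2k] or [2k + 1] carries a 1.
    Either way some position does, so that every [r] yields infinitely many
    1s. *)
Definition cut_digits (R : realType) (a : nat -> nat) (r : R) (i : nat) : bool :=
  `[< exists k, i = sparse_pos a (k.*2 + cut_bit R r k) >].

Section CutDigits.
Context {R : realType} {a : nat -> nat} (aa : arithmetic_sequence a).
Implicit Type r : R.

Lemma cut_digits_sparse r i : cut_digits R a r i -> exists k, i = sparse_pos a k.
Proof. by move=> /asboolP[k ->]; eexists. Qed.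

Lemma cut_digits_gap r i : cut_digits R a r i -> ~~ cut_digits R a r i.+1.
Proof.
move=> /cut_digits_sparse[k ->]; apply/negP => /cut_digits_sparse[l e].
have kl : (k < l)%N by apply: (sparse_pos_lt a) => //; rewrite -e.
by have := sparse_pos_homo a k l aa kl; rewrite -e ltnn.
Qed.

Lemma cut_digits_unbounded r K : exists2 k, (K <= k)%N & cut_digits R a r k.+1.
Proof.
have := sparse_pos_gt a (K.*2 + cut_bit R r K) aa.
case e : (sparse_pos _ _) => [//|k] Kk; exists k; first by lia.
by apply/asboolP; exists K.
Qed.

Lemma cut_digits_inj r1 r2 :
  (forall n, cut_digits R a r1 n.+1 = cut_digits R a r2 n.+1) -> r1 = r2.
Proof.
move=> e; apply: cut_bit_inj; apply/funext => k.
have p0 := sparse_pos_gt a (k.*2 + cut_bit R r1 k) aa.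
have : cut_digits R a r2 (sparse_pos a (k.*2 + cut_bit R r1 k)).
  rewrite -(prednK (leq_ltn_trans (leq0n _) p0)) -e prednK ?(leq_ltn_trans _ p0)//.
  by apply/asboolP; exists k.
move=> /asboolP[l /(sparse_pos_inj a _ _ aa) kl].
have lk : k = l by move: kl; case: cut_bit; case: cut_bit; lia.
by move: kl; rewrite -lk => /addnI; case: cut_bit; case: cut_bit.
Qed.

End CutDigits.

(** * The difference of the two subgroups *)

Theorem corollary3p4 (R : realType) (a d : nat -> nat) :
  arithmetic_sequence a ->
  (forall m : nat, (1 <= m)%N ->
     (\sum_(0 <= i < m) ((ratios a (n - i))%:R - 1))
       / (\sum_(1 <= i < n.+1) ((ratios a i)%:R - 1)) @[n --> \oo] --> (0 : R)) ->
  associated_sequence a d ->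
  t_char R (fun n => (d n)%:Z) `<` t_stat_char R (fun n => (d n)%:Z) /\
  t_stat_char R (fun n => (d n)%:Z) `\` t_char R (fun n => (d n)%:Z)
    #= [set: R].
Proof.
move=> aa /(slow_blocks_of_cvg R a aa) slow ad.
pose f (r : R) := (\pi_(circle R) (digit_sum R a (cut_digits R a r)))%qT.
have fD r : (t_stat_char R (fun n => (d n)%:Z) `\` t_char R (fun n => (d n)%:Z)) (f r).
  split; first by apply: digit_sum_stat => // i; exact: cut_digits_sparse.
  apply: digit_sum_notin => //; first exact: cut_digits_gap.
  exact: cut_digits_unbounded.
have f_inj : injective f.
  move=> r1 r2 /digit_sum_inj-/(_ aa (cut_digits_gap aa _) (cut_digits_gap aa _)).
  exact: cut_digits_inj.
split.
  split; first exact: t_char_sub_stat.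
  by move=> sub; case: (fD 0) => /sub.
apply/card_eqPle; split.
  apply/pcard_injP; exists (repr : circle R -> R) => x y _ _ e.
  by rewrite -[x]reprK e reprK.
have <- : f @^-1` (t_stat_char R (fun n => (d n)%:Z) `\` t_char R (fun n => (d n)%:Z)) = [set: R].
  by apply/seteqP; split=> // r _; exact: fD.
by apply: card_ge_preimage => r1 r2 _ _; exact: f_inj.
Qed.
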